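(* Let $\mathcal T$ be a reduced T-mesh, $\mathbf r$ a smoothness distribution on $\mathcal T$ that is constant along each maximal segment, and $m,m'\ge 0$ integers. Let $\iota:\rho_1\succ\rho_2\succ\cdots\succ\rho_t$ be a total order of $\operatorname{MIS}(\mathcal T)=\{\rho_1,\dots,\rho_t\}$, and set $\mathcal A_i:=\{\rho_i,\rho_{i+1},\ldots,\rho_t\}$ for $1\le i\le t$ and $\mathcal A_{t+1}:=\varnothing$. If, for some $i\in\{1,\dots,t\}$, the relative weight of $\rho_i$ reaches its threshold, i.e. $\omega_\iota(\rho_i)\ge\theta(\rho_i)$, then the inclusion $\mathcal M(\mathcal A_{i+1})\hookrightarrow\mathcal M(\mathcal A_i)$ induces an isomorphism of vector spaces $$\mathcal H_{m,m'}^{\mathbf r}(\mathcal A_{i+1};\mathcal T)\;\cong\;\mathcal H_{m,m'}^{\mathbf r}(\mathcal A_i;\mathcal T).$$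
   Context: **T-meshes.** Coordinates on $\mathbb R^2$ are $(s,t)$, with $s$ horizontal and $t$ vertical. Let $\Omega\subset\mathbb R^2$ be a finite union of closed axis-aligned rectangles with pairwise disjoint interiors, with $\Omega$ simply connected and $\Omega^\circ$ connected. A T-mesh on $\Omega$ is a triple $\mathcal T=(\mathcal T_2,\mathcal T_1,\mathcal T_0)$: $\mathcal T_2$ is the finite set of these closed rectangles (cells); $\mathcal T_1=\mathcal T_1^h\cup\mathcal T_1^v$ is a finite set of closed horizontal and vertical segments (edges) contained in $\bigcup_{\sigma\in\mathcal T_2}\partial\sigma$; $\mathcal T_0$ is the set of endpoints of edges (vertices); each $\partial\sigma$ is a finite union of edges; distinct cells $\sigma,\sigma'$ satisfy $\sigma\cap\sigma'=\partial\sigma\cap\partial\sigma'$, a finite union of edges and vertices; distinct edges meet only in vertices. Interior edges $\mathcal T_1^\circ$ are the edges meeting $\Omega^\circ$; the other edges are boundary edges. Interior vertices $\mathcal T_0^\circ$ are the vertices in $\Omega^\circ$. **Maximal segments.** A segment is a connected union of edges lying on one straight line. $\operatorname{MS}(\mathcal T)$ is the set of maximal segments consisting of interior edges. Such a segment is a cross-cut if both endpoints lie on $\partial\Omega$, a ray if exactly one does, and a maximal interior segment (MIS) if it does not meet $\partial\Omega$; $\operatorname{MIS}(\mathcal T)=\operatorname{MIS}_h(\mathcal T)\cup\operatorname{MIS}_v(\mathcal T)$ (horizontal/vertical). A boundary maximal segment is a maximal connected union of boundary edges on one line. $\widehat{\operatorname{MS}}(\mathcal T)$ is the set of all cross-cuts,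 rays, MISs and boundary maximal segments. $\mathcal T$ is reduced if no vertex is inserted merely to divide a straight edge into two collinear edges, every vertex lies on exactly one horizontal and exactly one vertical member of $\widehat{\operatorname{MS}}(\mathcal T)$, and the edges are exactly the closed subsegments between consecutive vertices on these members (so an interior and a boundary maximal segment of the same direction never meet collinearly at a common endpoint). **Smoothness.** A smoothness distribution is a map $\mathbf r:\mathcal T_1\to\{-1,0,1,\dots\}$ equal to $-1$ on boundary edges. It is constant along each maximal segment if for every $\rho\in\operatorname{MS}(\mathcal T)$ all edges $\tau\subset\rho$ have the same value $\mathbf r(\tau)=:r(\rho)$. For $\gamma\in\mathcal T_0^\circ$ with horizontal and vertical maximal segments $\rho_h(\gamma),\rho_v(\gamma)$ through it, $r_h(\gamma):=r(\rho_v(\gamma))$ and $r_v(\gamma):=r(\rho_h(\gamma))$. **Correction spaces.** $R_{a,b}=\operatorname{span}_{\mathbb R}\{s^it^j:0\le i\le a,\,0\le j\le b\}$, and $R_{a,b}=0$ if $a<0$ or $b<0$. For a maximal segment $\rho$, $\ell_\rho$ is a nonzero affine linear polynomial vanishing on the line of $\rho$ (normalised as $s-s_0$ for the vertical line $s=s_0$ and $t-t_0$ for the horizontal line $t=t_0$). For an MIS $\rho$, $\mathcal B_\rho=R_{m,m'-r(\rho)-1}$ if $\rho$ is horizontal and $\mathcal B_\rho=R_{m-r(\rho)-1,m'}$ if $\rho$ is vertical. For $\mathcal A\subseteq\operatorname{MIS}(\mathcal T)$, $\mathcal M(\mathcal A)=\bigoplus_{\rho\in\mathcal A}[\rho]\mathcal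 B_\rho$, where $[\rho]$ is a formal symbol labelling the summand. $\mathcal R(\mathcal T)\subseteq\mathcal M(\operatorname{MIS}(\mathcal T))$ is the subspace spanned by the following vertex relations, for each interior vertex $\gamma=\rho_h\cap\rho_v$ ($\rho_h$ horizontal, $\rho_v$ vertical maximal segment) and each $q\in R_{m-r(\rho_v)-1,\,m'-r(\rho_h)-1}$: if both $\rho_h,\rho_v$ are MISs, $[\rho_v]\ell_{\rho_h}^{r(\rho_h)+1}q-[\rho_h]\ell_{\rho_v}^{r(\rho_v)+1}q$; if exactly one of them is an MIS (then $\gamma$ is called a mono-vertex of that MIS), the same expression with the term of the non-MIS segment omitted. Put $\mathcal R_{\mathcal A}(\mathcal T):=\mathcal M(\mathcal A)\cap\mathcal R(\mathcal T)$ and $\mathcal H_{m,m'}^{\mathbf r}(\mathcal A;\mathcal T):=\mathcal M(\mathcal A)/\mathcal R_{\mathcal A}(\mathcal T)$. **Relative weight.** For a total order $\iota:\rho_1\succ\cdots\succ\rho_t$ of $\operatorname{MIS}(\mathcal T)$, $\Gamma_\iota(\rho_i)$ is the set of vertices $\gamma$ on $\rho_i$ with $\gamma\notin\rho_j$ for all $j<i$. With $(a)_+=\max\{a,0\}$, put $\mu_h(\gamma)=(m-r_h(\gamma))_+$ and $\mu_v(\gamma)=(m'-r_v(\gamma))_+$. Then $\omega_\iota(\rho_i)=\sum_{\gamma\in\Gamma_\iota(\rho_i)}\mu_h(\gamma)$ if $\rho_i$ is horizontal, and $\omega_\iota(\rho_i)=\sum_{\gamma\in\Gamma_\iota(\rho_i)}\mu_v(\gamma)$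 if $\rho_i$ is vertical. The threshold is $\theta(\rho)=m+1$ for horizontal $\rho$ and $\theta(\rho)=m'+1$ for vertical $\rho$. *)

(* Defs.v *)
From HB Require Import structures.
From mathcomp Require Import all_boot all_order all_algebra.
From mathcomp Require Import generic_quotient ring_quotient polyXY.
From mathcomp Require Import all_classical all_reals topology normedtype.

Set Implicit Arguments.
Unset Strict Implicit.
Unset Printing Implicit Defensive.

Import Order.TTheory GRing.Theory Num.Theory.
Import numFieldTopology.Exports.

Local Open Scope classical_set_scope.
Local Open Scope ring_scope.
Local Open Scope quotient_scope.

Section Span.
Variables (K : nzRingType) (V : lmodType K).

Definition span (G : set V) : {pred V} :=
  [pred x | `[< exists (n : nat) (c : 'I_n -> K) (g : 'I_n -> V),
                 (forall k, G (g k)) /\ x = \sum_(k < n) c k *: g k >]].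

Lemma span_submod_closed (G : set V) : submod_closed (span G).
Proof.
split=> [|a u v /asboolP[n [c [g [Gg ->]]]] /asboolP[p [d [h [Gh ->]]]]].
  apply/asboolP; exists 0%N, (fun=> 0), (fun=> 0); rewrite big_ord0.
  by split=> // -[].
apply/asboolP; exists (n + p)%N,
  (fun k => match fintype.split k with inl j => a * c j | inr j => d j end),
  (fun k => match fintype.split k with inl j => g j | inr j => h j end); split.
  by move=> k; case: (fintype.split k).
rewrite big_split_ord scaler_sumr /=; congr (_ + _); apply: eq_bigr => k _.
  by rewrite -[lshift _ _]/(unsplit (inl k)) unsplitK scalerA.
by rewrite -[rshift _ _]/(unsplit (inr k)) unsplitK.
Qed.

HB.instance Definition _ (G : set V) :=
  GRing.isSubmodClosed.Build K V (span G) (span_submod_closed G).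

End Span.

Section Submodules.
Variables (K : nzRingType) (V : lmodType K).

Record submodule (M : submodClosed V) :=
  Submodule { submod_val :> V; submod_valP : submod_val \in M }.

HB.instance Definition _ (M : submodClosed V) := [isSub for @submod_val M].
HB.instance Definition _ (M : submodClosed V) := [Choice of submodule M by <:].
HB.instance Definition _ (M : submodClosed V) :=
  [SubChoice_isSubLmodule of submodule M by <:].

Definition submod_incl (M M' : submodClosed V) (MM' : {subset M <= M'})
    (x : submodule M) : submodule M' :=
  Submodule (MM' _ (submod_valP x)).

Definition capmod (M N : {pred V}) : {pred V} := [predI M & N].

Lemma capmod_submod_closed (M N : submodClosed V) :
  submod_closed (capmod M N).
Proof.
split=> [|a u v]; rewrite /capmod !inE ?rpred0 //.
by move=> /andP[Mu Nu] /andP[Mv Nv]; rewrite !rpredD ?rpredZ.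
Qed.

HB.instance Definition _ (M N : submodClosed V) :=
  GRing.isSubmodClosed.Build K V (capmod M N) (capmod_submod_closed M N).

Definition within_submod (M : submodClosed V) (N : {pred V}) :
  {pred submodule M} := [pred x | submod_val x \in N].

Arguments within_submod : clear implicits.

Lemma within_submod_closed (M N : submodClosed V) :
  submod_closed (within_submod M N).
Proof.
split=> [|a u v]; rewrite /within_submod !inE.
  by rewrite -[submod_val _]/(val _) raddf0 rpred0.
move=> Nu Nv; rewrite (GRing.valD (a *: u) v) (GRing.valZ a u).
by rewrite rpredD ?rpredZ.
Qed.

HB.instance Definition _ (M N : submodClosed V) :=
  GRing.isSubmodClosed.Build K (submodule M) (within_submod M N)
    (within_submod_closed M N).

End Submodules.

Arguments within_submod {K V} M N.

Section QuotientModule.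
Variables (K : nzRingType) (V : lmodType K) (N : submodClosed V).

(* [submodClosed] does not inherit from [zmodClosed], which [Quotient.quot]
   requires. *)
Definition submod_zmod : {pred V} := N.

Lemma submod_zmod_closed : zmod_closed submod_zmod.
Proof.
split=> [|x y Nx Ny]; first exact: rpred0 N.
by rewrite -scaleN1r; apply: (rpredD Nx); apply: (rpredZ (-1) Ny).
Qed.

HB.instance Definition _ :=
  GRing.isZmodClosed.Build V submod_zmod submod_zmod_closed.

Definition quotmod := Quotient.quot submod_zmod.

HB.instance Definition _ := GRing.Zmodule.on quotmod.
HB.instance Definition _ :=
  ZmodQuotient.on quotmod.

Definition quotmod_scale (a : K) := lift_op1 quotmod ( *:%R a).

Lemma pi_quotmod_scale a : {morph \pi_quotmod : x / a *: x >-> quotmod_scale a x}.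
Proof.
move=> x; unlock quotmod_scale; apply/eqP; rewrite -Quotient.idealrBE.
have xNx : x - repr (\pi_quotmod x) \in submod_zmod.
  by rewrite Quotient.idealrBE reprK.
by rewrite -scalerBr; apply: (@rpredZ K V N a).
Qed.

Lemma quotmod_scaleA a b x :
  quotmod_scale a (quotmod_scale b x) = quotmod_scale (a * b) x.
Proof. by rewrite -[x]reprK -!pi_quotmod_scale scalerA. Qed.

Lemma quotmod_scale1 : left_id 1 quotmod_scale.
Proof. by move=> x; rewrite -[x]reprK -pi_quotmod_scale scale1r. Qed.

Lemma quotmod_scaleDr : right_distributive quotmod_scale +%R.
Proof.
move=> a x y; rewrite -[x]reprK -[y]reprK -!pi_quotmod_scale -!raddfD /=.
by rewrite -pi_quotmod_scale scalerDr.
Qed.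

Lemma quotmod_scaleDl x : {morph quotmod_scale^~ x : a b / a + b}.
Proof.
by move=> a b; rewrite -[x]reprK -!pi_quotmod_scale scalerDl raddfD.
Qed.

HB.instance Definition _ := GRing.Zmodule_isLmodule.Build K quotmod
  quotmod_scaleA quotmod_scale1 quotmod_scaleDr quotmod_scaleDl.

End QuotientModule.

(* [{poly {poly R}}] is canonically a module over [{poly R}] only; [bipoly R] is
   the same ring with scalars restricted to [R].  As in polyXY, the first
   variable s is the outer ['X] and the second variable t is ['Y = 'X%:P]. *)
Definition bipoly (R : comNzRingType) := {poly {poly R}}.

Section BipolyModule.
Variable R : comNzRingType.

HB.instance Definition _ := GRing.ComNzRing.on (bipoly R).

Definition bipoly_scale (a : R) (p : bipoly R) : bipoly R := a%:P%:P * p.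

Lemma bipoly_scaleA a b p :
  bipoly_scale a (bipoly_scale b p) = bipoly_scale (a * b) p.
Proof. by rewrite /bipoly_scale mulrA -!polyCM. Qed.

Lemma bipoly_scale1 : left_id 1 bipoly_scale.
Proof. by move=> p; rewrite /bipoly_scale mul1r. Qed.

Lemma bipoly_scaleDr : right_distributive bipoly_scale +%R.
Proof. by move=> a p q; rewrite /bipoly_scale mulrDr. Qed.

Lemma bipoly_scaleDl p : {morph bipoly_scale^~ p : a b / a + b}.
Proof. by move=> a b; rewrite /bipoly_scale !polyCD mulrDl. Qed.

HB.instance Definition _ := GRing.Zmodule_isLmodule.Build R (bipoly R)
  bipoly_scaleA bipoly_scale1 bipoly_scaleDr bipoly_scaleDl.

(* The space R_{a,b}; it is 0 as soon as a < 0 or b < 0. *)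
Definition Rpoly (a b : int) : {pred bipoly R} :=
  span [set p : bipoly R | exists i j : nat,
    [/\ (i%:Z <= a)%R, (j%:Z <= b)%R & p = 'X^i * 'Y ^+ j]].

End BipolyModule.

Section Topology.
Variable R : realType.
Local Notation point := (R * R)%type.
Implicit Types A : set point.

Definition frontier A : set point := closure A `\` A°.

Definition path_in A (x y : point) (f : R -> point) : Prop :=
  [/\ {within `[0, 1], continuous f}, f @` `[0, 1] `<=` A, f 0 = x & f 1 = y].

(* [H] is a based null-homotopy of the loop [f]; its first argument is the
   homotopy parameter. *)
Definition simply_connected A : Prop :=
  (forall x y, A x -> A y -> exists f, path_in A x y f) /\
  (forall x f, path_in A x x f -> exists H : R * R -> point,
     [/\ {within `[0, 1] `*` `[0, 1], continuous H},
         H @` (`[0, 1] `*` `[0, 1]) `<=` A,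
         {in `[0, 1], forall u, H (0, u) = f u /\ H (1, u) = x} &
         {in `[0, 1], forall v, H (v, 0) = x /\ H (v, 1) = x}]).

End Topology.

Section Tmesh.
Variable R : realType.
Local Notation point := (R * R)%type.
Implicit Types (A e rho : set point) (p : point).

Definition is_rect A : Prop := exists a b c d : R,
  [/\ a < b, c < d & A = `[a, b] `*` `[c, d]].

Definition hseg (a b t : R) : set point := `[a, b] `*` [set t].
Definition vseg (s c d : R) : set point := [set s] `*` `[c, d].

Definition is_seg A : Prop :=
  (exists a b t, a < b /\ A = hseg a b t) \/
  (exists s c d, c < d /\ A = vseg s c d).

Definition endpoints A : set point := [set p |
  (exists a b t, [/\ a < b, A = hseg a b t & p = (a, t) \/ p = (b, t)]) \/
  (exists s c d, [/\ c < d, A = vseg s c d & p = (s, c) \/ p = (s, d)])].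

Definition horizontal A : Prop := exists t0, A `<=` [set p | p.2 = t0].
Definition vertical A : Prop := exists s0, A `<=` [set p | p.1 = s0].

Record tmesh := Tmesh {
  cells : set (set point);
  edges : set (set point);
  domain : set point := \bigcup_(sigma in cells) sigma;
  vertices : set point := \bigcup_(e in edges) endpoints e;
  cells_finite : finite_set cells;
  cells_rect : forall sigma, cells sigma -> is_rect sigma;
  cells_disjoint : forall sigma sigma', cells sigma -> cells sigma' ->
    sigma <> sigma' -> sigma° `&` sigma'° = set0;
  domain_simply_connected : simply_connected domain;
  domain_interior_connected : connected domain°;
  edges_finite : finite_set edges;
  edges_seg : forall e, edges e -> is_seg e;
  edges_sub : forall e, edges e ->
    e `<=` \bigcup_(sigma in cells) frontier sigma;
  cells_frontier : forall sigma, cells sigma ->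
    exists2 E, E `<=` edges & frontier sigma = \bigcup_(e in E) e;
  cells_meet : forall sigma sigma', cells sigma -> cells sigma' ->
    sigma <> sigma' ->
    sigma `&` sigma' = frontier sigma `&` frontier sigma' /\
    exists E V, [/\ E `<=` edges, V `<=` vertices &
      sigma `&` sigma' = (\bigcup_(e in E) e) `|` V];
  edges_meet : forall e e', edges e -> edges e' -> e <> e' ->
    e `&` e' `<=` vertices
}.

Section Segments.
Variable T : tmesh.

Definition interior_edges : set (set point) :=
  [set e | edges T e /\ e `&` (domain T)° !=set0].
Definition boundary_edges : set (set point) := edges T `\` interior_edges.
Definition interior_vertices : set point := vertices T `&` (domain T)°.

Definition segment_of (E : set (set point)) : set (set point) :=
  [set rho | [/\ connected rho, horizontal rho \/ vertical rho &
    exists E', [/\ E' `<=` E, E' !=set0 & rho = \bigcup_(e in E') e]]].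

Definition maximal_segment (E : set (set point)) : set (set point) :=
  [set rho | segment_of E rho /\
    forall rho', segment_of E rho' -> rho `<=` rho' -> rho' = rho].

Definition MS : set (set point) := maximal_segment interior_edges.
Definition boundary_MS : set (set point) := maximal_segment boundary_edges.

Definition cross_cuts : set (set point) :=
  [set rho | MS rho /\ endpoints rho `<=` frontier (domain T)].
Definition rays : set (set point) :=
  [set rho | MS rho /\ exists p q, [/\ endpoints rho = [set p; q],
     frontier (domain T) p & ~ frontier (domain T) q]].
Definition MIS : set (set point) :=
  [set rho | MS rho /\ rho `&` frontier (domain T) = set0].
Definition hatMS : set (set point) :=
  cross_cuts `|` rays `|` MIS `|` boundary_MS.

Definition reduced : Prop :=
  [/\ (forall p, vertices T p -> ~ exists e1 e2,
          [/\ e1 <> e2,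
              (horizontal e1 /\ horizontal e2) \/ (vertical e1 /\ vertical e2) &
              [set e | edges T e /\ e p] = [set e1; e2]]),
      (forall p, vertices T p ->
          (exists! rho, [/\ hatMS rho, horizontal rho & rho p]) /\
          (exists! rho, [/\ hatMS rho, vertical rho & rho p])) &
      (* A segment joins consecutive vertices of [rho] iff its endpoints are
         the only vertices it contains. *)
      edges T = [set e | is_seg e /\ exists2 rho, hatMS rho &
                   e `<=` rho /\ e `&` vertices T = endpoints e]].

(* Only the values of [r] on edges are meaningful. *)
Definition smoothness_distribution (r : set point -> int) : Prop :=
  (forall e, edges T e -> -1 <= r e) /\
  (forall e, boundary_edges e -> r e = -1).

Definition constant_along_MS (r : set point -> int) : Prop :=
  forall rho, MS rho -> forall e e', edges T e -> edges T e' ->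
    e `<=` rho -> e' `<=` rho -> r e = r e'.

Variables (r : set point -> int) (m m' : nat).

(* r(rho): the common value of [r] on the edges contained in [rho], under
   [constant_along_MS] *)
Definition seg_r rho : int :=
  xget (-1) [set k | exists2 e, edges T e & e `<=` rho /\ r e = k].

Definition rho_h p : set point :=
  xget set0 [set rho | [/\ MS rho, horizontal rho & rho p]].
Definition rho_v p : set point :=
  xget set0 [set rho | [/\ MS rho, vertical rho & rho p]].

Definition r_h p : int := seg_r (rho_v p).
Definition r_v p : int := seg_r (rho_h p).

Definition line_coord (c : point -> R) rho : R :=
  xget 0 [set x | rho `<=` [set p | c p = x]].

Definition ell rho : bipoly R :=
  if `[< horizontal rho >] then 'Y - (line_coord snd rho)%:P%:P
  else 'X - (line_coord fst rho)%:P%:P.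

Definition Bspace rho : {pred bipoly R} :=
  if `[< horizontal rho >] then Rpoly m%:Z (m'%:Z - seg_r rho - 1)
  else Rpoly (m%:Z - seg_r rho - 1) m'%:Z.

(* The formal symbol [rho] p, as a family supported at [rho] *)
Definition summand rho (p : bipoly R) : set point -> bipoly R :=
  fun rho' => if `[< rho' = rho >] then p else 0.

(* The direct sum M(A) consists of all families supported in A with values in
   the B_rho: A is meant to be a subset of MIS, which is finite. *)
Definition Mspace (A : set (set point)) : {pred set point -> bipoly R} :=
  [pred f | `[< forall rho, (A rho -> f rho \in Bspace rho) /\
                            (~ A rho -> f rho = 0) >]].

Lemma Bspace_submod_closed rho : submod_closed (Bspace rho).
Proof. by rewrite /Bspace; case: asboolP => _; exact: span_submod_closed. Qed.

Lemma Mspace_submod_closed (A : set (set point)) : submod_closed (Mspace A).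
Proof.
split=> [|a f g /asboolP Mf /asboolP Mg]; apply/asboolP => rho.
  by split=> // _; case: (Bspace_submod_closed rho).
have [[fA fN] [gA gN]] := (Mf rho, Mg rho); split=> Arho.
  by case: (Bspace_submod_closed rho) => _; apply; [exact: fA|exact: gA].
by rewrite -[LHS]/(a *: f rho + g rho) fN // gN // scaler0 addr0.
Qed.

HB.instance Definition _ (A : set (set point)) := GRing.isSubmodClosed.Build R
  (set point -> bipoly R) (Mspace A) (@Mspace_submod_closed A).

Lemma Mspace_sub (A A' : set (set point)) :
  A `<=` A' -> {subset Mspace A <= Mspace A'}.
Proof.
move=> AA' f /asboolP Mf; apply/asboolP => rho; have [fA fN] := Mf rho.
split=> [_|NA'rho]; last by apply: fN => /AA'.
have [/fA //|/fN ->] := pselect (A rho).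
by case: (Bspace_submod_closed rho).
Qed.

(* [absz (k + 1)] is k + 1 as a natural number, since k >= -1. *)
Definition vertex_relations : set (set point -> bipoly R) :=
  [set f | exists p rhoh rhov (q : bipoly R),
    [/\ interior_vertices p, MS rhoh /\ horizontal rhoh,
        MS rhov /\ vertical rhov & rhoh `&` rhov = [set p]] /\
    [/\ MIS rhoh \/ MIS rhov,
        q \in Rpoly (m%:Z - seg_r rhov - 1) (m'%:Z - seg_r rhoh - 1) &
        f = (if `[< MIS rhov >]
             then summand rhov (ell rhoh ^+ absz (seg_r rhoh + 1) * q) else 0) -
            (if `[< MIS rhoh >]
             then summand rhoh (ell rhov ^+ absz (seg_r rhov + 1) * q) else 0)]].

Definition relations : {pred set point -> bipoly R} := span vertex_relations.

HB.instance Definition _ := GRing.SubmodClosed.on relations.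

Definition relations_in (A : set (set point)) :
  {pred set point -> bipoly R} := capmod (Mspace A) relations.

HB.instance Definition _ (A : set (set point)) :=
  GRing.SubmodClosed.on (relations_in A).

Definition Hspace (A : set (set point)) : lmodType R :=
  quotmod (within_submod (Mspace A) (relations_in A)).

Definition Hclass (A : set (set point)) (x : submodule (Mspace A)) : Hspace A :=
  \pi_(quotmod (within_submod (Mspace A) (relations_in A))) x.

Section Order.
Variables (t : nat) (rho : 'I_t -> set point).

(* With 0-based indices, [tail k] is A_{k+1} = {rho_(k+1), ..., rho_t}. *)
Definition tail (k : nat) : set (set point) :=
  rho @` [set j : 'I_t | (k <= j)%N].

Lemma tailS k : tail k.+1 `<=` tail k.
Proof. by move=> _ [j /= kj <-]; exists j => //=; exact: ltnW. Qed.

Definition new_vertices (i : 'I_t) : set point :=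
  [set p | [/\ vertices T p, rho i p & forall j : 'I_t, (j < i)%N -> ~ rho j p]].

Definition mu_h p : int := Num.max (m%:Z - r_h p) 0.
Definition mu_v p : int := Num.max (m'%:Z - r_v p) 0.

Definition weight (i : 'I_t) : int :=
  if `[< horizontal (rho i) >] then \sum_(p \in new_vertices i) mu_h p
  else \sum_(p \in new_vertices i) mu_v p.

Definition threshold (i : 'I_t) : int :=
  if `[< horizontal (rho i) >] then (m.+1)%:Z else (m'.+1)%:Z.

End Order.

End Segments.
End Tmesh.

(* Main.v *)
(** The induced map is always injective, since [R_A = M(A) /\ R].  For
    surjectivity, every [b] in [B_(rho_i)] must be congruent, modulo the vertex
    relations, to an element of [M(A_(i+1))].  At a vertex of [rho_i] lying on
    no earlier MIS, the crossing segment is either no MIS or a later one, so the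
    relations there absorb [ell^(r+1) * q].  It remains to see that, for distinct
    points [x_k] and multiplicities [n_k] of sum at least [m + 1], the powers
    [(X - x_k)^j] with [m - n_k < j <= m] span the polynomials of degree at most
    [m].  This goes by induction on [m]: the polar derivative
    [(X - x_0) p' - m p] lowers the degree, uses up one unit of multiplicity at
    [x_0] and none elsewhere, and its kernel is spanned by [(X - x_0)^m]. *)

From HB Require Import structures.
Require Import Defs.
From mathcomp Require Import all_boot all_order all_algebra.
From mathcomp Require Import generic_quotient ring_quotient polyXY zify.
From mathcomp Require Import all_classical all_reals topology normedtype.

Set Implicit Arguments.
Unset Strict Implicit.
Unset Printing Implicit Defensive.

Import Order.TTheory GRing.Theory Num.Theory.
Import numFieldTopology.Exports.
Local Open Scope classical_set_scope.
Local Open Scope ring_scope.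
Local Open Scope quotient_scope.

(** * Polar derivatives and spans of powers of linear polynomials *)

Section PolarDerivative.
Variables (R : numFieldType) (a : R) (m : nat).

(** Up to sign, the classical polar derivative with pole [a] of [p] regarded as a form of degree
    [m]; this [m] is fixed beforehand, whatever the degree of [p]. *)
Definition polar (p : {poly R}) : {poly R} :=
  ('X - a%:P) * p^`() - m%:R *: p.

Lemma polarP c (p q : {poly R}) : polar (c *: p + q) = c *: polar p + polar q.
Proof.
rewrite /polar derivD derivZ mulrDr -scalerAr scalerDr scalerBr opprD addrACA.
by rewrite !scalerA [m%:R * _]mulrC.
Qed.

(** In degree [m] both terms contribute [m] times the same coefficient of [p] and cancel. *)
Lemma size_polar (p : {poly R}) : (size p <= m.+1)%N -> (size (polar p) <= m)%N.
Proof.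
move=> /leq_sizeP sp; apply/leq_sizeP => j mj.
rewrite /polar mulrBl coefB coefZ coefB coefXM coefCM !coef_deriv.
case: j mj => [|j].
  by rewrite leqn0 => /eqP m0; rewrite sp ?m0 // !mul0r mulr0 subrr subr0.
move=> mj; rewrite (sp j.+2) ?ltnS // mul0rn mulr0 subr0 /=; move: mj.
rewrite leq_eqVlt => /orP[/eqP->|/sp->]; last by rewrite mul0rn mulr0 subr0.
by rewrite mulr_natl subrr.
Qed.

(** Translating [a] to 0 gives Euler's equation for [u]: [j] times the coefficient of degree [j] is
    [m] times it, so in characteristic zero only degree [m] survives. *)
Lemma polar_ker (p : {poly R}) :
  polar p = 0 -> exists c, p = c *: ('X - a%:P) ^+ m.
Proof.
move=> Ep; pose u := p \Po ('X + a%:P).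
have Eu : 'X * u^`() = m%:R *: u.
  apply/eqP; rewrite -subr_eq0 /u deriv_comp derivD derivX derivC addr0 mulr1.
  have <- : polar p \Po ('X + a%:P) = 0 by rewrite Ep comp_poly0.
  rewrite /polar comp_polyB comp_polyM comp_polyB comp_polyX comp_polyC addrK.
  by rewrite comp_polyZ.
have uE : u = u`_m *: 'X^m.
  apply/polyP => j; rewrite coefZ coefXn; have [->|jm] := eqVneq j m.
    by rewrite mulr1.
  have := congr1 (fun q : {poly R} => q`_j) Eu; rewrite coefXM coefZ coef_deriv.
  case: j jm => [|j] jm /=.
    move/esym/eqP; rewrite mulf_eq0 pnatr_eq0 eq_sym (negPf jm) /= => /eqP->.
    by rewrite mulr0.
  move/eqP; rewrite -[u`__ *+ _]mulr_natl -subr_eq0 -mulrBl mulf_eq0.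
  rewrite subr_eq0 eqr_nat.
  by rewrite (negPf jm) /= => /eqP->; rewrite mulr0.
exists u`_m; have <- : u \Po ('X - a%:P) = p.
  by rewrite /u -comp_polyA comp_polyD comp_polyX comp_polyC subrK comp_polyXr.
by rewrite {1}uE comp_polyZ comp_Xn_poly.
Qed.

(** Write ['X - a%:P] as [(b - a)%:P + ('X - b%:P)]. At [j = 0] the truncated exponent [j.-1] is
    harmless, its coefficient being 0. *)
Lemma polar_pow b j :
  polar (('X - b%:P) ^+ j) = (j%:R * (b - a)) *: ('X - b%:P) ^+ j.-1
                             + (j%:R - m%:R) *: ('X - b%:P) ^+ j.
Proof.
have -> : polar (('X - b%:P) ^+ j) =
    (b - a) *: ('X - b%:P) ^+ j.-1 *+ j + ('X - b%:P) ^+ j *+ j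
    - m%:R *: ('X - b%:P) ^+ j.
  rewrite /polar deriv_exp derivB derivX derivC subr0 mul1r; congr (_ - _).
  have -> : 'X - a%:P = (b - a)%:P + ('X - b%:P).
    by rewrite polyCB [RHS]addrC [RHS]addrA subrK.
  case: j => [|j]; first by rewrite !mulr0n mulr0 addr0.
  by rewrite mulrDl !mulrnAr mul_polyC exprS.
by rewrite [(j%:R - _) *: _]scalerBl addrA -!scaler_nat scalerA.
Qed.

End PolarDerivative.

(** Taking for [W] any predicate closed under linear combinations lets the induction pass to its
    image under [polar], and later lets [W] be a congruence condition. *)
Lemma shifted_powers_span (R : numFieldType) (I : eqType) (x : I -> R) (m : nat)
    (W : {poly R} -> Prop) (pts : seq I) (n : I -> nat) :
  W 0 -> (forall c p q, W p -> W q -> W (c *: p + q)) -> uniq pts ->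
  {in pts &, injective x} ->
  (m < \sum_(a <- pts) n a)%N ->
  (forall a k, a \in pts -> (k < n a)%N -> (k <= m)%N ->
     W (('X - (x a)%:P) ^+ (m - k))) ->
  forall p : {poly R}, (size p <= m.+1)%N -> W p.
Proof.
move=> + + Upts xinj; elim: m W n => [|m IHm] W n W0 Wlin mn Wpow p sp.
all: have [a0 a0pts na0] : exists2 a, a \in pts & (0 < n a)%N.
1,3: apply/hasP; apply: contraLR mn => /hasPn n0; rewrite -leqNgt.
1,2: by rewrite big1_seq // => a /= /n0; rewrite lt0n negbK => /eqP.
- have W1 := Wpow _ _ a0pts na0 isT.
  by rewrite (size1_polyC sp) -alg_polyC -[X in W X]addr0; apply: Wlin.
(* This power spans the kernel of [polar (x a0) m.+1]; it corrects the preimage at the end. *)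
have mX : W (('X - (x a0)%:P) ^+ m.+1) by rewrite -[m.+1]subn0; apply: Wpow.
pose W' q := exists2 w, W w & polar (x a0) m.+1 w = q.
pose n' a := if a == a0 then (n a).-1 else n a.
have W'lin c p1 q1 : W' p1 -> W' q1 -> W' (c *: p1 + q1).
  move=> [w Ww <-] [v Wv <-]; exists (c *: w + v); rewrite ?polarP //.
  exact: Wlin.
have W'0 : W' 0.
  by exists 0 => //; rewrite /polar deriv0 mulr0 scaler0 subrr.
have W'Z c p1 : W' p1 -> W' (c *: p1).
  by move=> W'p; rewrite -[_ *: _]addr0; apply: W'lin.
have [w Ww Ew] : W' (polar (x a0) m.+1 p).
  apply: (IHm W' n') => //; last exact: size_polar.
    suff nE : (\sum_(a <- pts) n a = (\sum_(a <- pts) n' a).+1)%N.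
      by rewrite -ltnS -nE.
    rewrite (big_rem a0) //= [in RHS](big_rem a0) //= {1}/n' eqxx -addSn.
    rewrite prednK //; congr (_ + _)%N.
    rewrite big_seq [RHS]big_seq; apply: eq_bigr => a.
    by rewrite /n' mem_rem_uniq // inE => /andP[/negPf->].
  (* At [a0] the exponent [m - k] is [m.+1 - k.+1], which costs the lost unit of multiplicity; the
     power is an eigenvector of [polar] with nonzero eigenvalue [- k.+1%:R]. *)
  move=> a k apts; rewrite /n'; have [->|aa0] := eqVneq a a0 => kn km.
    have := Wpow a0 k.+1 a0pts; rewrite subSS ltnS km -ltn_predRL kn.
    move=> /(_ isT isT) Wp.
    have -> : ('X - (x a0)%:P) ^+ (m - k) =
      - (k.+1%:R)^-1 *: polar (x a0) m.+1 (('X - (x a0)%:P) ^+ (m - k)).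
      rewrite polar_pow subrr mulr0 scale0r add0r scalerA natrB //.
      rewrite -[m.+1]addn1 -[k.+1]addn1 !natrD.
      have -> : m%:R - k%:R - (m%:R + 1) = - (k%:R + 1) :> R.
        by rewrite addrAC opprD addrA subrr add0r addrC opprD.
      by rewrite mulrNN mulVf ?scale1r // natr1 pnatr_eq0.
    by apply: W'Z; exists (('X - (x a0)%:P) ^+ (m - k)).
  (* At other points nothing is lost. The top power of exponent [m.+1] has only its lower term in
     [polar_pow]; each further power yields the next one modulo a power already in [W']. The
     coefficients are invertible since [x a] differs from [x a0]. *)
  elim: k kn km => [|k IHk] kn km.
    have := Wpow a 0%N apts kn isT; rewrite !subn0 => Wp.
    have -> : ('X - (x a)%:P) ^+ m =
      (m.+1%:R * (x a - x a0))^-1 *: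
        polar (x a0) m.+1 (('X - (x a)%:P) ^+ m.+1).
      rewrite polar_pow subrr scale0r addr0 scalerA mulVf ?scale1r //.
      by rewrite mulf_neq0 ?subr_eq0 ?(inj_in_eq xinj) ?pnatr_eq0.
    by apply: W'Z; exists (('X - (x a)%:P) ^+ m.+1).
  have Wp := Wpow a k.+1 apts kn (leqW km); rewrite subSS in Wp.
  have W'k := IHk (ltnW kn) (ltnW km).
  have -> : ('X - (x a)%:P) ^+ (m - k.+1) =
      ((m - k)%:R * (x a - x a0))^-1 *: ((m.+1%:R - (m - k)%:R) *:
         ('X - (x a)%:P) ^+ (m - k) +
           polar (x a0) m.+1 (('X - (x a)%:P) ^+ (m - k))).
    rewrite polar_pow addrCA -scalerDl addrA subrK subrr scale0r addr0 scalerA.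
    rewrite subnS mulVf ?scale1r // mulf_neq0 ?subr_eq0 ?(inj_in_eq xinj) //.
    by rewrite pnatr_eq0 subn_eq0 -ltnNge.
  by apply/W'Z/W'lin => //; exists (('X - (x a)%:P) ^+ (m - k)).
(* [w] and [p] have the same polar derivative, so they differ by a multiple of the power in [mX]. *)
have /polar_ker[c pwc] : polar (x a0) m.+1 (-1 *: w + p) = 0.
  by rewrite polarP Ew scaleN1r addNr.
have -> : p = c *: ('X - (x a0)%:P) ^+ m.+1 + w.
  by rewrite -pwc scaleN1r addrAC addNr add0r.
exact: Wlin.
Qed.

(** * Maps of quotients induced by an inclusion *)

Section QuotientClasses.
Variables (K : nzRingType) (V : lmodType K).

Lemma submod_rpredB (M : submodClosed V) (x y : V) :
  x \in M -> y \in M -> x - y \in M.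
Proof. by move=> Mx My; rewrite -scaleN1r rpredD ?rpredZ. Qed.

Lemma submod_val_linear (M : submodClosed V) a (x y : submodule M) :
  submod_val (a *: x + y) = a *: submod_val x + submod_val y.
Proof.
by rewrite -[submod_val _]/(val _) (GRing.valD (a *: x) y) (GRing.valZ a x).
Qed.

Lemma quotmod_piP (N : submodClosed V) (x y : V) :
  (\pi_(quotmod N) x = \pi_(quotmod N) y) <-> (x - y \in N).
Proof.
split=> [/eqP|Nxy]; first by rewrite -Quotient.idealrBE.
by apply/eqP; rewrite -Quotient.idealrBE.
Qed.

Lemma quotmod_pi_linear (N : submodClosed V) (a : K) (x y : V) :
  \pi_(quotmod N) (a *: x + y) = a *: \pi_(quotmod N) x + \pi_(quotmod N) y.
Proof. by rewrite raddfD /= pi_quotmod_scale. Qed.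

End QuotientClasses.

(** Both quotients are by the intersection with the same [N], so injectivity is automatic; the
    hypothesis is exactly surjectivity. *)
Lemma quotmod_incl_bij (K : nzRingType) (V : lmodType K)
    (M M' N : submodClosed V) (MM' : {subset M <= M'}) :
  (forall x, x \in M' -> exists2 y, y \in M & x - y \in N) ->
  exists2 phi : {linear quotmod (within_submod M (capmod M N)) ->
                        quotmod (within_submod M' (capmod M' N))},
    bijective phi &
    forall x : submodule M,
      phi (\pi_(quotmod (within_submod M (capmod M N))) x) =
      \pi_(quotmod (within_submod M' (capmod M' N))) (submod_incl MM' x).
Proof.
move=> surj.
pose Q := quotmod (within_submod M (capmod M N)).
pose Q' := quotmod (within_submod M' (capmod M' N)).
(* Defined on chosen representatives; [fpi] shows that the choice does not matter. *)
pose f (x : Q) : Q' := \pi_Q' (submod_incl MM' (repr x)).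
have inN (x y : submodule M) :
    (x - y \in within_submod M (capmod M N)) = (val x - val y \in N).
  rewrite !inE -[submod_val _]/(val (x - y)) raddfB /=.
  by rewrite (submod_rpredB (submod_valP x) (submod_valP y)).
have inN' (x y : submodule M') :
    (x - y \in within_submod M' (capmod M' N)) = (val x - val y \in N).
  rewrite !inE -[submod_val _]/(val (x - y)) raddfB /=.
  by rewrite (submod_rpredB (submod_valP x) (submod_valP y)).
have fpi x : f (\pi_Q x) = \pi_Q' (submod_incl MM' x).
  rewrite /f; apply/quotmod_piP; rewrite inN' /= -inN; apply/quotmod_piP.
  by rewrite reprK.
have flin : linear f.
  move=> a x y; rewrite -[x]reprK -[y]reprK -quotmod_pi_linear !fpi.
  rewrite -quotmod_pi_linear; congr (\pi_Q' _); apply: val_inj.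
  exact: etrans (submod_val_linear _ _ _) (esym (submod_val_linear _ _ _)).
pose phi : {linear Q -> Q'} :=
  HB.pack f (GRing.isLinear.Build K Q Q' *:%R f flin).
exists phi => //=.
(* [bijective] asks for an inverse function, so preimages are chosen with [cid]. *)
have g_ex (x : Q') : {y : Q | f y = x}.
  apply: cid; have [y My Nxy] := surj _ (submod_valP (repr x)).
  exists (\pi_Q (Submodule My)); rewrite fpi -[RHS]reprK.
  by apply/quotmod_piP; rewrite inN' /= -opprB -scaleN1r rpredZ.
have finj : injective f.
  move=> x y; rewrite -[x]reprK -[y]reprK !fpi => /quotmod_piP.
  by rewrite inN' /= -inN => /quotmod_piP.
exists (fun x => sval (g_ex x)) => x; last by case: (g_ex x).
by apply: finj; case: (g_ex (f x)).
Qed.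

(** * Spans and the polynomial spaces of bounded bidegree *)

Section SpanTheory.
Variables (K : nzRingType) (V : lmodType K).

Lemma mem_span (G : set V) x : G x -> x \in Defs.span G.
Proof.
move=> Gx; apply/asboolP; exists 1%N, (fun=> 1), (fun=> x).
by rewrite big_ord1 scale1r.
Qed.

Lemma span_ind (G : set V) (P : V -> Prop) :
  P 0 -> (forall c x y, P x -> P y -> P (c *: x + y)) ->
  (forall x, G x -> P x) -> forall x, x \in Defs.span G -> P x.
Proof.
move=> P0 Plin PG x /asboolP[n [c [g [Gg ->]]]].
by elim/big_rec: _ => // k y _ Py; apply: Plin => //; apply: PG.
Qed.

End SpanTheory.

Section RpolyTheory.
Variable R : comNzRingType.
Implicit Types (a b : int) (p q : bipoly R).

Lemma Rpoly_monomial a b (i j : nat) : i%:Z <= a -> j%:Z <= b ->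
  ('X^i * 'Y ^+ j : bipoly R) \in Rpoly a b.
Proof. by move=> ia jb; apply: mem_span; exists i, j. Qed.

Lemma Rpoly_ind a b (P : bipoly R -> Prop) :
  P 0 -> (forall c p q, P p -> P q -> P (c *: p + q)) ->
  (forall i j : nat, i%:Z <= a -> j%:Z <= b -> P ('X^i * 'Y ^+ j)) ->
  forall p, p \in Rpoly a b -> P p.
Proof.
move=> P0 Plin PX; apply: span_ind => // p [i [j [ia jb ->]]].
exact: PX.
Qed.

Lemma Rpoly_le a b a' b' : a <= a' -> b <= b' ->
  {subset Rpoly a b <= (Rpoly a' b' : {pred bipoly R})}.
Proof.
move=> aa' bb'; apply: Rpoly_ind => [|c p q Pp Pq|i j ia jb].
- exact: rpred0.
- by rewrite rpredD ?rpredZ.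
- by apply: Rpoly_monomial; [exact: le_trans aa'|exact: le_trans bb'].
Qed.

(** Exponents of monomials add; a negative bound leaves no monomial to treat. *)
Lemma Rpoly_mul a b a' b' p q : p \in Rpoly a b -> q \in Rpoly a' b' ->
  p * q \in Rpoly (a + a') (b + b').
Proof.
move=> + Rq; move: p; apply: Rpoly_ind => [|c p p' Pp Pp'|i j ia jb].
- by rewrite mul0r rpred0.
(* [c *: p] is by definition a product with a constant polynomial, so associativity moves the scalar
   out. *)
- by rewrite mulrDl -[(c *: p) * q]mulrA rpredD ?rpredZ.
move: q Rq; apply: Rpoly_ind => [|c q q' Pq Pq'|k l ka lb].
- by rewrite mulr0 rpred0.
- by rewrite mulrDr [_ * (c *: q)]mulrCA rpredD ?rpredZ.
by rewrite mulrACA -!exprD; apply: Rpoly_monomial; rewrite PoszD lerD.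
Qed.

Lemma Rpoly_exp p (n : nat) a b : p \in Rpoly a b ->
  p ^+ n \in Rpoly (a *+ n) (b *+ n).
Proof.
move=> Rp; elim: n => [|n IHn]; last by rewrite exprS !mulrS Rpoly_mul.
have -> : p ^+ 0 = 'X^0 * 'Y ^+ 0 by rewrite !expr0 mulr1.
exact: Rpoly_monomial.
Qed.

Lemma Rpoly_expX (c : R) (n : nat) :
  (('X - c%:P%:P) ^+ n : bipoly R) \in Rpoly n%:Z 0.
Proof.
have : ('X - c%:P%:P : bipoly R) \in Rpoly 1 0.
  have -> : 'X - c%:P%:P = - c *: ('X^0 * 'Y ^+ 0 : bipoly R) +
    ('X^1 * 'Y ^+ 0 : bipoly R).
    by rewrite [_ *: _]/(bipoly_scale _ _) /bipoly_scale !mulr1 !polyCN addrC.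
  by apply: rpredD; [apply: rpredZ|]; exact: Rpoly_monomial.
by move/(Rpoly_exp n); rewrite mul0rn natz.
Qed.

Lemma Rpoly_expY (c : R) (n : nat) :
  (('Y - c%:P%:P) ^+ n : bipoly R) \in Rpoly 0 n%:Z.
Proof.
have : ('Y - c%:P%:P : bipoly R) \in Rpoly 0 1.
  have -> : 'Y - c%:P%:P = - c *: ('X^0 * 'Y ^+ 0 : bipoly R) +
    ('X^0 * 'Y ^+ 1 : bipoly R).
    by rewrite [_ *: _]/(bipoly_scale _ _) /bipoly_scale !mulr1 !polyCN addrC
      mul1r.
  by apply: rpredD; [apply: rpredZ|]; exact: Rpoly_monomial.
by move/(Rpoly_exp n); rewrite mul0rn natz.
Qed.

End RpolyTheory.

(** * The spanning result in two variables *)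

Section BivariateSpan.
Variables (R : numFieldType) (I : eqType) (x : I -> R) (m : nat) (b : int).
Variables (pts : seq I) (s : I -> int) (W : bipoly R -> Prop).
Hypotheses (W0 : W 0) (Wlin : forall c p q, W p -> W q -> W (c *: p + q)).
Hypotheses (Upts : uniq pts) (xinj : {in pts &, injective x}).
Hypothesis s_ge : forall i, -1 <= s i.
Hypothesis wt : m.+1%:Z <= \sum_(i <- pts) Num.max (m%:Z - s i) 0.

Let n i := absz (Num.max (m%:Z - s i) 0).

Let wt_nat : (m < \sum_(i <- pts) n i)%N.
Proof.
suff nE : \sum_(i <- pts) Num.max (m%:Z - s i) 0 = (\sum_(i <- pts) n i)%N%:Z.
  by rewrite -lez_nat -nE.
rewrite (big_morph Posz PoszD (erefl 0%:Z)); apply: eq_bigr => i _.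
by rewrite /n gez0_abs // le_max lexx orbT.
Qed.

(** For [k < n i] the power of exponent [m - k] contains the factor of exponent [s i + 1] occurring
    in the relations, and the cofactor obeys their degree bound. *)
Let split_exponent i k : (k < n i)%N -> (k <= m)%N ->
  exists e d, [/\ s i + 1 = e%:Z, (m - k = e + d)%N & d%:Z <= m%:Z - s i - 1].
Proof.
rewrite /n => kn km; exists (absz (s i + 1)), (m - k - absz (s i + 1)%R)%N.
have := s_ge i; move: kn; case: leP => ms kn si; split; lia.
Qed.

(** With the power of ['Y] fixed, [W] becomes a condition on univariate polynomials, embedded in the
    outer variable by [^:P]. *)
Lemma span_translatesX :
  (forall i q, i \in pts -> q \in Rpoly (m%:Z - s i - 1) b ->
     W (('X - (x i)%:P%:P) ^+ absz (s i + 1) * q)) ->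
  forall q, q \in Rpoly m%:Z b -> W q.
Proof.
move=> Wq; apply: Rpoly_ind => // i j im jb.
pose V (p : {poly R}) := W (p^:P * 'Y ^+ j).
suff : V 'X^i by rewrite /V map_polyXn.
apply: (@shifted_powers_span _ _ x m V pts n) => //;
  last by rewrite size_polyXn.
- by rewrite /V rmorph0 mul0r.
- move=> c p q Vp Vq; rewrite /V rmorphD /= map_polyZ mulrDl.
  by rewrite -mul_polyC -mulrA; apply: Wlin.
- move=> a k apts kn km; rewrite /V rmorphXn rmorphB /= map_polyX map_polyC /=.
  have [e [d [se -> dm]]] := split_exponent kn km.
  rewrite exprD -mulrA -[e]/(absz e) -se; apply: Wq => //.
  have Yj : ('Y ^+ j : bipoly R) \in Rpoly 0 b.
    by rewrite -['Y ^+ j]mul1r; apply: (@Rpoly_monomial _ 0 b 0).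
  by apply: Rpoly_le (Rpoly_mul (Rpoly_expX (x a) d) Yj); rewrite ?addr0 ?add0r.
Qed.

(** The variables are exchanged: univariate polynomials now enter as coefficients [p%:P]. *)
Lemma span_translatesY :
  (forall i q, i \in pts -> q \in Rpoly b (m%:Z - s i - 1) ->
     W (('Y - (x i)%:P%:P) ^+ absz (s i + 1) * q)) ->
  forall q, q \in Rpoly b m%:Z -> W q.
Proof.
move=> Wq; apply: Rpoly_ind => // i j ib jm.
pose V (p : {poly R}) := W (p%:P * 'X^i).
suff : V 'X^j by rewrite /V mulrC rmorphXn.
apply: (@shifted_powers_span _ _ x m V pts n) => //;
  last by rewrite size_polyXn.
- by rewrite /V mul0r.
- move=> c p q Vp Vq; rewrite /V polyCD -mul_polyC polyCM mulrDl -mulrA.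
  exact: Wlin.
- move=> a k apts kn km; rewrite /V rmorphXn /= polyCB.
  have [e [d [se -> dm]]] := split_exponent kn km.
  rewrite exprD -mulrA -[e]/(absz e) -se; apply: Wq => //.
  have Xi : ('X^i : bipoly R) \in Rpoly b 0.
    by rewrite -['X^i]mulr1; apply: (@Rpoly_monomial _ b 0 _ 0).
  by apply: Rpoly_le (Rpoly_mul (Rpoly_expY (x a) d) Xi); rewrite ?addr0 ?add0r.
Qed.

End BivariateSpan.

(** * Edges and maximal segments at interior vertices *)

Section SegmentGeometry.
Variables (R : realType) (T : tmesh R).
Implicit Types (e rho : set (R * R)) (p : R * R).

Lemma rect_closed (A : set (R * R)) : is_rect A -> closed A.
Proof.
move=> [a [b [c [d [_ _ ->]]]]]; have -> : `[a, b] `*` `[c, d] =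
  (@fst R R @^-1` `[a, b]) `&` (@snd R R @^-1` `[c, d]) by [].
apply: closedI; apply: preimage_closed; try exact: itv_closed.
  by move=> x _; exact: cvg_fst.
by move=> x _; exact: cvg_snd.
Qed.

Lemma edge_sub_domain e : edges T e -> e `<=` domain T.
Proof.
move=> Te p /(edges_sub Te)[A TA [Ap _]]; exists A => //.
by have /closure_id -> : closed A by apply: rect_closed; apply: cells_rect TA.
Qed.

Lemma edge_not_hv e : edges T e -> horizontal e -> vertical e -> False.
Proof.
move=> /edges_seg[[a [b [t [ab ->]]]]|[s [c [d [cd ->]]]]] [t0 ht] [s0 vs].
  have h x : a <= x <= b -> x = s0 by move=> xab; apply: (vs (x, t)); split.
  have ha : a = s0 by apply: h; rewrite lexx ltW.
  have hb : b = s0 by apply: h; rewrite lexx ltW.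
  by rewrite ha hb ltxx in ab.
have h y : c <= y <= d -> y = t0 by move=> ycd; apply: (ht (s, y)); split.
have hc : c = t0 by apply: h; rewrite lexx ltW.
have hd : d = t0 by apply: h; rewrite lexx ltW.
by rewrite hc hd ltxx in cd.
Qed.

Lemma MS_not_hv rho : MS T rho -> horizontal rho -> vertical rho -> False.
Proof.
move=> [[_ _ [E [Eint [e Ee] ->]]] _] [t0 ht] [s0 vs].
have [Te _] := Eint _ Ee.
by apply: (edge_not_hv Te); [exists t0|exists s0] => p ep;
  [apply: ht|apply: vs]; exists e.
Qed.

(** Rules out the remaining direction once a segment is known not to be horizontal. *)
Lemma MS_hv rho : MS T rho -> horizontal rho \/ vertical rho.
Proof. by case=> -[]. Qed.

(** Edges lie in the domain, and a point of it outside the interior would be on the frontier, which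
    an MIS avoids. *)
Lemma MIS_interior rho p : MIS T rho -> rho p -> (domain T)° p.
Proof.
move=> [[[_ _ [E [Eint _ rhoE]]] _] rho0] rhop; apply: contrapT => Nintp.
suff : (rho `&` frontier (domain T)) p by rewrite rho0.
split=> //; split=> //; apply: subset_closure.
move: rhop; rewrite rhoE => -[e Ee ep].
exact: edge_sub_domain (proj1 (Eint _ Ee)) _ ep.
Qed.

Lemma hatMS_MS rho p : (domain T)° p -> rho p -> hatMS T rho -> MS T rho.
Proof.
move=> intp rhop [[[[]|[]]|[]]|[[_ _ [E [Ebd _ rhoE]]] _]] //.
move: rhop; rewrite rhoE => -[e /Ebd[Te Nint] ep].
by case: Nint; split=> //; exists p.
Qed.

(** Reducedness supplies a vertical member of [hatMS] through [p], and it is in [MS] because [p] is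
    interior; so [xget] does not fall back on its default. *)
Lemma rho_vP p : reduced T -> vertices T p -> (domain T)° p ->
  [/\ MS T (rho_v T p), vertical (rho_v T p) & rho_v T p p].
Proof.
move=> [_ /[swap] _ /[swap] Tp /(_ _ Tp)[_ [rho [[hrho vrho rhop] _]]]] intp.
apply: (@xgetPex _ set0 [set rho | [/\ MS T rho, vertical rho & rho p]]).
by exists rho; split=> //; exact: hatMS_MS intp rhop hrho.
Qed.

Lemma rho_hP p : reduced T -> vertices T p -> (domain T)° p ->
  [/\ MS T (rho_h T p), horizontal (rho_h T p) & rho_h T p p].
Proof.
move=> [_ /[swap] _ /[swap] Tp /(_ _ Tp)[[rho [[hrho vrho rhop] _]] _]] intp.
apply: (@xgetPex _ set0 [set rho | [/\ MS T rho, horizontal rho & rho p]]).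
by exists rho; split=> //; exact: hatMS_MS intp rhop hrho.
Qed.

Lemma ell_horizontal rho p : horizontal rho -> rho p ->
  ell rho = 'Y - (p.2)%:P%:P.
Proof.
move=> hrho rhop; rewrite /ell asboolT //; congr (_ - _%:P%:P).
have [t0 ht] := hrho; have pt := ht _ rhop.
apply: xget_unique => [q /ht|y /(_ _ rhop)] //=.
by rewrite pt.
Qed.

(** [ell] tests horizontality first; a maximal segment, containing a nondegenerate edge, cannot have
    both directions. *)
Lemma ell_vertical rho p : MS T rho -> vertical rho -> rho p ->
  ell rho = 'X - (p.1)%:P%:P.
Proof.
move=> Mrho vrho rhop; rewrite /ell asboolF; last first.
  by move=> hrho; exact: MS_not_hv Mrho hrho vrho.
congr (_ - _%:P%:P); have [s0 vs] := vrho; have ps := vs _ rhop.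
apply: xget_unique => [q /vs|y /(_ _ rhop)] //=.
by rewrite ps.
Qed.

Lemma hv_meet rhoh rhov p : horizontal rhoh -> vertical rhov ->
  rhoh p -> rhov p -> rhoh `&` rhov = [set p].
Proof.
move=> [t0 ht] [s0 vs] hp vp; apply/seteqP; split=> [q [hq vq]|_ ->] //=.
by rewrite [q]surjective_pairing [p]surjective_pairing
  (ht _ hq) (ht _ hp) (vs _ vq) (vs _ vp).
Qed.

Lemma seg_r_ge (r : set (R * R) -> int) rho :
  smoothness_distribution T r -> -1 <= seg_r T r rho.
Proof.
move=> [r_ge _]; rewrite /seg_r.
(* The default value -1 satisfies the bound as well. *)
by case: xgetP => // k _ [e Te [_ <-]]; apply: r_ge.
Qed.

End SegmentGeometry.

(** * Absorbing the summand of a segment of large weight *)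

Section Absorption.
Variables (R : realType) (T : tmesh R) (r : set (R * R) -> int).
Variables (m m' t : nat) (rho : 'I_t -> set (R * R)) (i : 'I_t).
Implicit Types (p : R * R) (b q : bipoly R).

Lemma summand_linear (e : set (R * R)) (a : R) b q :
  summand e (a *: b + q) = a *: summand e b + summand e q.
Proof.
apply/funext => e'; rewrite /summand -[RHS]/(a *: _ + _).
by case: asboolP => // _; rewrite scaler0 addr0.
Qed.

Lemma summand0 (e : set (R * R)) : summand e (0 : bipoly R) = 0.
Proof. by apply/funext => e'; rewrite /summand; case: asboolP. Qed.

Lemma summand_Mspace (A : set (set (R * R))) e b :
  A e -> b \in Bspace T r m m' e -> summand e b \in Mspace T r m m' A.
Proof.
move=> Ae Bb; apply/asboolP => e'; rewrite /summand.
case: asboolP => [->|_]; first by split.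
by split=> // _; case: (Bspace_submod_closed T r m m' e').
Qed.

(** Surjectivity of the induced map on the summand of [rho i]; this is the [W] of the spanning
    lemmas. *)
Definition absorbed (b : bipoly R) : Prop :=
  exists2 g, g \in Mspace T r m m' (tail rho i.+1) &
    summand (rho i) b - g \in relations T r m m'.

Lemma absorbed0 : absorbed 0.
Proof. by exists 0; rewrite ?summand0 ?subr0; apply: rpred0. Qed.

Lemma absorbed_linear (a : R) b q :
  absorbed b -> absorbed q -> absorbed (a *: b + q).
Proof.
move=> [g Mg Rg] [h Mh Rh]; exists (a *: g + h).
  by apply: rpredD => //; apply: rpredZ.
rewrite summand_linear opprD addrACA -scalerBr.
by apply: rpredD => //; apply: rpredZ.
Qed.

Hypotheses (redT : reduced T) (smooth : smoothness_distribution T r).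
Hypothesis rho_bij : set_bij [set: 'I_t] (MIS T) rho.

Let MISi j : MIS T (rho j).
Proof. by case: rho_bij => fun_rho _ _; exact: fun_rho. Qed.

(** A new vertex avoids all earlier MISs, so any other MIS through it comes later. *)
Lemma tail_of_MIS p e : new_vertices T rho i p -> MIS T e -> e p ->
  e <> rho i -> tail rho i.+1 e.
Proof.
move=> [_ _ newp]; case: rho_bij => _ _ surj /surj[j _ <-] jp ji.
exists j => //=; rewrite ltn_neqAle; apply/andP; split.
  by apply/eqP => /val_inj ij; rewrite ij in ji.
by rewrite leqNgt; apply/negP => /newp.
Qed.

Let absz_seg_r e : (absz (seg_r T r e + 1))%:Z = seg_r T r e + 1.
Proof. by have := seg_r_ge e smooth; lia. Qed.

Lemma absorbed_horizontal p q : horizontal (rho i) -> new_vertices T rho i p ->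
  q \in Rpoly (m%:Z - r_h T r p - 1) (m'%:Z - seg_r T r (rho i) - 1) ->
  absorbed (('X - (p.1)%:P%:P) ^+ absz (r_h T r p + 1) * q).
Proof.
move=> hrho newp Rq; have [Tp rhop _] := newp.
have intp := MIS_interior (MISi i) rhop.
have [Mv vv vp] := rho_vP redT Tp intp.
rewrite /r_h -(ell_vertical Mv vv vp).
(* The other half of the vertex relation at [p], equal to 0 at a mono-vertex. *)
set g := if `[< MIS T (rho_v T p) >]
  then summand (rho_v T p) (ell (rho i) ^+ absz (seg_r T r (rho i) + 1) * q)
  else 0.
exists g.
  rewrite /g; case: asboolP => MISv; last exact: rpred0.
  apply: summand_Mspace.
    apply: tail_of_MIS newp MISv vp _ => vE.
    by apply: MS_not_hv Mv _ vv; rewrite vE.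
  rewrite /Bspace asboolF; last by move=> hv; exact: MS_not_hv Mv hv vv.
  rewrite (ell_horizontal hrho rhop).
  (* The power of [ell (rho i)] raises the bound on the degree in ['Y] to exactly [m']. *)
  apply: Rpoly_le (Rpoly_mul (Rpoly_expY _ _) Rq); first by rewrite add0r.
  by rewrite absz_seg_r; lia.
(* The horizontal summand enters the vertex relation with a minus sign. *)
rewrite -opprB -scaleN1r; apply: rpredZ; apply: mem_span.
exists p, (rho i), (rho_v T p), q; split; split=> //.
- by split=> //; case: (MISi i).
- exact: hv_meet.
- by left.
- by congr (_ - _); rewrite asboolT.
Qed.

Lemma absorbed_vertical p q : vertical (rho i) -> new_vertices T rho i p ->
  q \in Rpoly (m%:Z - seg_r T r (rho i) - 1) (m'%:Z - r_v T r p - 1) ->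
  absorbed (('Y - (p.2)%:P%:P) ^+ absz (r_v T r p + 1) * q).
Proof.
move=> vrho newp Rq; have [Tp rhop _] := newp.
have [Mrho _] := MISi i; have intp := MIS_interior (MISi i) rhop.
have [Mh hh hp] := rho_hP redT Tp intp.
rewrite /r_v -(ell_horizontal hh hp).
set g := if `[< MIS T (rho_h T p) >]
  then summand (rho_h T p) (ell (rho i) ^+ absz (seg_r T r (rho i) + 1) * q)
  else 0.
exists g.
  rewrite /g; case: asboolP => MISh; last exact: rpred0.
  apply: summand_Mspace.
    apply: tail_of_MIS newp MISh hp _ => hE.
    by apply: MS_not_hv Mh hh _; rewrite hE.
  rewrite /Bspace asboolT // (ell_vertical Mrho vrho rhop).
  apply: Rpoly_le (Rpoly_mul (Rpoly_expX _ _) Rq); last by rewrite add0r.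
  by rewrite absz_seg_r; lia.
apply: mem_span.
exists p, (rho_h T p), (rho i), q; split; split=> //.
- exact: hv_meet.
- by right.
- by congr (_ - _); rewrite asboolT.
Qed.

Lemma absorbed_Bspace : threshold m m' rho i <= weight T r m m' rho i ->
  forall b, b \in Bspace T r m m' (rho i) -> absorbed b.
Proof.
rewrite /threshold /weight /Bspace; case: asboolP => [hrho|Nhrho].
  (* A sum of infinite support is 0 by convention, hence below the threshold; otherwise [X] collects
     the new vertices of nonzero contribution. *)
  case: finite_supportP => [|X XP _ _ wt]; first by rewrite big_nil.
  apply: (@span_translatesX _ _ (@fst R R) _ _ (finmap.enum_fset X)
    (r_h T r)) => //.
  - exact: absorbed0.
  - exact: absorbed_linear.
  - exact: finmap.fset_uniq.
  - have [t0 ht] := hrho.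
    move=> p q /XP[_ /ht pt _] /XP[_ /ht qt _] pq.
    by rewrite [p]surjective_pairing [q]surjective_pairing pq pt qt.
  - by move=> p; apply: seg_r_ge.
  - by move=> p q /XP newp; apply: absorbed_horizontal.
have vrho : vertical (rho i).
  by have [/MS_hv[]] := MISi i.
case: finite_supportP => [|X XP _ _ wt]; first by rewrite big_nil.
apply: (@span_translatesY _ _ (@snd R R) _ _ (finmap.enum_fset X)
  (r_v T r)) => //.
- exact: absorbed0.
- exact: absorbed_linear.
- exact: finmap.fset_uniq.
- have [s0 vs] := vrho.
  move=> p q /XP[_ /vs ps _] /XP[_ /vs qs _] pq.
  by rewrite [p]surjective_pairing [q]surjective_pairing pq ps qs.
- by move=> p; apply: seg_r_ge.
- by move=> p q /XP newp; apply: absorbed_vertical.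
Qed.

Lemma absorbed_tail : threshold m m' rho i <= weight T r m m' rho i ->
  forall f, f \in Mspace T r m m' (tail rho i) ->
  exists2 g, g \in Mspace T r m m' (tail rho i.+1) &
    f - g \in relations T r m m'.
Proof.
move=> wt f /asboolP Mf.
have tail_i : tail rho i (rho i) by exists i => /=.
have [g Mg Rg] := absorbed_Bspace wt ((Mf (rho i)).1 tail_i).
(* Only the component at [rho i] is replaced; the others already lie in the smaller direct sum. *)
exists (f - summand (rho i) (f (rho i)) + g); last first.
  by rewrite opprD opprB addrA addrCA subrr addr0.
apply: rpredD => //; apply/asboolP => e.
rewrite -[(f - _) e]/(f e - summand (rho i) (f (rho i)) e).
rewrite /summand; case: asboolP => [->|Ne].
  by rewrite subrr; split=> // _; case: (Bspace_submod_closed T r m m' (rho i)).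
rewrite subr0; split=> [/tailS|Ntail]; first exact: (Mf e).1.
apply: (Mf e).2 => -[j /= ij je]; apply: Ntail; exists j => //=.
by rewrite ltn_neqAle ij andbT; apply/eqP => /val_inj ji; rewrite -je ji in Ne.
Qed.

End Absorption.

Theorem theorem3p7 (R : realType) (T : tmesh R) (r : set (R * R) -> int)
    (m m' t : nat) (rho : 'I_t -> set (R * R)) (i : 'I_t) :
  reduced T ->
  smoothness_distribution T r ->
  constant_along_MS T r ->
  set_bij [set: 'I_t] (MIS T) rho ->
  threshold m m' rho i <= weight T r m m' rho i ->
  exists2 phi : {linear Hspace T r m m' (tail rho i.+1) ->
                        Hspace T r m m' (tail rho i)},
    bijective phi &
    forall x : submodule (Mspace T r m m' (tail rho i.+1)),
      phi (Hclass x) = Hclass (submod_incl (Mspace_sub (@tailS R t rho i)) x).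
Proof.
move=> redT smooth _ rho_bij wt.
exact: quotmod_incl_bij (absorbed_tail redT smooth rho_bij wt).
Qed.
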